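(* Let $(T,\mathcal{G})$ be a Tychonoff topological space and let $M$ be a non-empty subset of $\mathfrak{RM}_b(T,\mathcal{G})_+$. Suppose that $M$ is closed in $\mathfrak{RM}_b(T,\mathcal{G})$ with respect to the weak topology $\mathcal{G}_w(\mathfrak{RM}_b(T,\mathcal{G}),C_b(T,\mathcal{G}))$ and has the following two properties: $(\alpha^{z})$ for every net $(\mu_j)_{j\in J}$ in $M$ there exists a subnet $(\mu_{j_i})_{i\in I}$ such that for every $\varepsilon>0$ there are a compact set $C\subset T$ and an index $i_0\in I$ such that $\mu_{j_i}(T\setminus C)<\varepsilon$ for every $i\geqslant i_0$; $(\beta)$ $\sup\{\mu(T)\mid\mu\in M\}<\infty$. Then $M$ is compact in the topology induced on it by $\mathcal{G}_w(\mathfrak{RM}_b(T,\mathcal{G}),C_b(T,\mathcal{G}))$.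
   Context: Tychonoff means completely regular and Hausdorff. $\mathcal{B}$ is the Borel $\sigma$-algebra of $(T,\mathcal{G})$. A bounded (signed, real-valued, countably additive) measure $\mu:\mathcal{B}\to\mathbb{R}$ is a bounded Radon measure if for every $B\in\mathcal{B}$ and every $\varepsilon>0$ there is a compact $C\subset B$ with $|\mu B-\mu C|<\varepsilon$. $\mathfrak{RM}_b(T,\mathcal{G})$ is the linear space of all bounded Radon measures, and $\mathfrak{RM}_b(T,\mathcal{G})_+$ is its subset of positive measures. $C_b(T,\mathcal{G})$ is the space of bounded continuous functions $T\to\mathbb{R}$. For $f\in C_b(T,\mathcal{G})$, $\int f\,d\mu=\int f\,d\mu_+-\int f\,d(-\mu_-)$ with $\mu_+=\mu\vee 0$, $\mu_-=\mu\wedge 0$. The weak topology $\mathcal{G}_w(\mathfrak{RM}_b(T,\mathcal{G}),C_b(T,\mathcal{G}))$ is the topology on $\mathfrak{RM}_b(T,\mathcal{G})$ generated by the seminorms $\mu\mapsto|\int f\,d\mu|$, $f\in C_b(T,\mathcal{G})$. Subnets are taken in the usual (Kelley) sense: $I$ is a directed set and $i\mapsto j_i\in J$ is a map such that for every $j_0\in J$ there is $i_0\in I$ with $j_i\geqslant j_0$ for all $i\geqslant i_0$. Compact means: Hausdorff and every open cover has a finite subcover. *)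

(* Defs.v *)
From HB Require Import structures.
From mathcomp Require Import all_boot all_order all_algebra.
From mathcomp Require Import all_classical all_reals all_analysis.

Set Implicit Arguments.
Unset Strict Implicit.
Unset Printing Implicit Defensive.

Import Order.TTheory GRing.Theory Num.Theory.
Import numFieldNormedType.Exports.

Local Open Scope classical_set_scope.
Local Open Scope ring_scope.

Definition tychonoff_space (T : topologicalType) : Prop :=
  completely_regular_space T /\ hausdorff_space T.

Lemma completely_regularP (R : realType) (T : topologicalType) :
  completely_regular_space T <->
  forall (a : T) (B : set T), closed B -> ~ B a ->
    exists f : T -> R, [/\ continuous f, range f `<=` `[0, 1],
      f a = 0 & forall x, B x -> f x = 1].
Proof.
split=> [crT a B cB /(crT _ _ cB)|h a B cB /(h _ _ cB)].
  move/(@uniform_separatorP _ R) => [f [cf f01 fa fB]]; exists f; split => //.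
  - by apply: (fa (f a)); exists a.
  - by move=> x Bx; apply: (fB (f x)); exists x.
move=> [f [cf f01 fa fB]]; apply/(@uniform_separatorP _ R).
exists f; split => //; first by move=> _ [_ -> <-].
by move=> _ [x /fB + <-].
Qed.

(* Compactness includes the Hausdorff property of the subspace [A]; [set_type A]
   carries the topology induced from [X]. *)
Definition compact_hausdorff (X : topologicalType) (A : set X) : Prop :=
  hausdorff_space (set_type A) /\ cover_compact A.

Notation borel T := (g_sigma_algebraType (@open T)).

Section charge_integral.
Context d (T : measurableType d) (R : realType).
Implicit Types (nu lam : {charge set T -> \bar R}) (f : T -> R).

Let hahn_sig nu := cid (Hahn_decomposition nu).
Let hahn_sig2 nu := cid (svalP (hahn_sig nu)).

Definition hahn_pos nu : set T := sval (hahn_sig nu).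
Definition hahn_neg nu : set T := sval (hahn_sig2 nu).

Lemma hahn_posneg nu : hahn_decomposition nu (hahn_pos nu) (hahn_neg nu).
Proof. exact: svalP (hahn_sig2 nu). Qed.

(* [nu \/ 0] and [- (nu /\ 0)] in the lattice of finite charges; they do not
   depend on the chosen Hahn decomposition, see [charge_pos_lub] and
   [charge_neg_glb]. *)
Definition charge_pos nu : {finite_measure set T -> \bar R} :=
  jordan_pos (hahn_posneg nu).
Definition charge_neg nu : {finite_measure set T -> \bar R} :=
  jordan_neg (hahn_posneg nu).

Definition charge_int nu f : R :=
  \int[charge_pos nu]_x f x - \int[charge_neg nu]_x f x.

Lemma charge_decomp nu A : measurable A ->
  nu A = (charge_pos nu A - charge_neg nu A)%E.
Proof.
by move=> mA; rewrite (jordan_decomp (hahn_posneg nu) mA) /cadd/= cscaleN1.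
Qed.

Lemma charge_pos_ub nu A : measurable A -> (nu A <= charge_pos nu A)%E.
Proof.
by move=> mA; rewrite charge_decomp// leeBlDr ?fin_num_measure// leeDl.
Qed.

Lemma charge_pos_lub nu lam :
  (forall A, measurable A -> (0 <= lam A)%E) ->
  (forall A, measurable A -> (nu A <= lam A)%E) ->
  forall A, measurable A -> (charge_pos nu A <= lam A)%E.
Proof.
move=> lam0 nulam A mA; have [[mP _] _ _ _] := hahn_posneg nu.
rewrite /charge_pos /= jordan_posE cjordan_posE /crestr0 mem_set// /crestr.
rewrite (chargeDI lam mA mP) (le_trans (nulam _ _))//; first exact: measurableI.
by rewrite leeDr// lam0//; exact: measurableD.
Qed.

Lemma charge_neg_lb nu A : measurable A -> (- charge_neg nu A <= nu A)%E.
Proof. by move=> mA; rewrite charge_decomp// leeDr. Qed.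

Lemma charge_neg_glb nu lam :
  (forall A, measurable A -> (lam A <= 0)%E) ->
  (forall A, measurable A -> (lam A <= nu A)%E) ->
  forall A, measurable A -> (lam A <= - charge_neg nu A)%E.
Proof.
move=> lam0 lamnu A mA; have [_ [mN _] _ _] := hahn_posneg nu.
rewrite /charge_neg /= jordan_negE cjordan_negE oppeK.
rewrite /crestr0 mem_set// /crestr.
rewrite (chargeDI lam mA mN) (le_trans _ (lamnu _ _))//; last exact: measurableI.
by rewrite geeDr// lam0//; exact: measurableD.
Qed.

End charge_integral.

Section radon_measure.
Context (R : realType) (T : ptopologicalType).

(* A charge is a function on all subsets of [T] whose values off the sigma-algebra
   are unconstrained. Since a Radon measure is a function on the Borel sets only,
   these values are normalized to [0]; otherwise equality would be too fine and
   the weak topology would not separate points. *)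
Record radon_measure := RadonMeasure {
  radon_charge :> {charge set (borel T) -> \bar R} ;
  radon_out : forall A : set (borel T), ~ measurable A -> radon_charge A = 0%E ;
  radon_inner : forall B : set (borel T), measurable B ->
    forall e : R, 0 < e -> exists2 C : set T,
      compact_hausdorff C /\ C `<=` B &
      (`|radon_charge B - radon_charge C| < e%:E)%E }.

HB.instance Definition _ := gen_eqMixin radon_measure.
HB.instance Definition _ := gen_choiceMixin radon_measure.

Definition radon_ge0 : set radon_measure :=
  [set mu | forall B : set (borel T), measurable B -> (0 <= mu B)%E].

Definition bounded_continuous : set (T -> R) :=
  [set f | continuous f /\ bounded_fun f].

(* The value at [nu - mu] of the seminorm [mu |-> |\int f dmu|]. *)
Definition weak_dist (f : T -> R) (nu mu : radon_measure) : R :=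
  `|charge_int (cadd nu (copp mu)) f|.

Definition weak_ball (fs : seq (T -> R)) (e : R) (mu : radon_measure) :
    set radon_measure :=
  [set nu | forall f, f \in fs -> weak_dist f nu mu < e].

Definition weak_open (U : set radon_measure) : Prop :=
  forall mu, U mu -> exists (fs : seq (T -> R)) (e : R),
    [/\ 0 < e, {in fs, forall f, bounded_continuous f} &
        weak_ball fs e mu `<=` U].

Let weak_openT : weak_open setT.
Proof. by move=> mu _; exists [::], 1; split. Qed.

Let weak_openI : setI_closed weak_open.
Proof.
move=> U V oU oV mu [/oU[fs [e [e0 fsb UB]]] /oV[gs [e' [e'0 gsb VB]]]].
exists (fs ++ gs), (Num.min e e'); split.
- by rewrite lt_min e0.
- by move=> f; rewrite mem_cat => /orP[/fsb|/gsb].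
- move=> nu B; split; [apply: UB|apply: VB] => f ff.
  + by have := B f; rewrite mem_cat ff lt_min => /(_ isT) /andP[].
  + by have := B f; rewrite mem_cat ff orbT lt_min => /(_ isT) /andP[].
Qed.

Let weak_open_bigU (I : Type) (U : I -> set radon_measure) :
  (forall i, weak_open (U i)) -> weak_open (\bigcup_i U i).
Proof.
move=> oU mu [i _ /oU[fs [e [e0 fsb UB]]]]; exists fs, e; split => //.
by move=> nu /UB ?; exists i.
Qed.

HB.instance Definition _ := isOpenTopological.Build radon_measure
  weak_openT weak_openI weak_open_bigU.

End radon_measure.

Definition directed (J : Type) (le : J -> J -> Prop) : Prop :=
  [/\ inhabited J, (forall j, le j j),
      (forall i j k, le i j -> le j k -> le i k) &
      forall i j, exists k, le i k /\ le j k].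

Definition is_subnet (I J : Type) (leI : I -> I -> Prop) (leJ : J -> J -> Prop)
    (s : I -> J) : Prop :=
  forall j0, exists i0, forall i, leI i0 i -> leJ j0 (s i).

Definition eventually_tight_subnets (R : realType) (T : ptopologicalType)
    (M : set (radon_measure R T)) : Prop :=
  forall (J : Type) (leJ : J -> J -> Prop), directed leJ ->
  forall mu : J -> radon_measure R T, (forall j, M (mu j)) ->
  exists (I : Type) (leI : I -> I -> Prop) (s : I -> J),
    [/\ directed leI, is_subnet leI leJ s &
        forall e : R, 0 < e ->
        exists (C : set T) (i0 : I), compact_hausdorff C /\
          forall i, leI i0 i -> (mu (s i) (~` C) < e%:E)%E].

(* Main.v *)
(* Let F be an ultrafilter containing M. Property alpha, applied to the net that
   selects a member of M in each A of F, makes F tight: for every e there is a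
   compact C with [mu (~` C) < e] F-eventually. For U open put
   m(U) = lim_F mu(U), and for K compact cap(K) = inf m(U) over open U
   containing K. The set function cap is additive on disjoint compacts, so
   G |-> sup cap(K) over compact K in G generates an outer measure whose
   restriction nu to the Borel sets is Radon with nu <= m on open sets;
   tightness gives nu(T) = m(T). Bounding f with values in [0, 1] by
   n^-1 * \sum_(k < n) \1_[set x | k < n * f x] yields
   \int f dnu <= lim_F \int f dmu; applied to f and - f this is F --> nu, and
   nu is in M since M is closed. *)
Require Import Defs.
From HB Require Import structures.
From mathcomp Require Import all_boot all_order all_algebra.
From mathcomp Require Import all_classical all_reals all_analysis.
From mathcomp Require Import finmap lra.

Set Implicit Arguments.
Unset Strict Implicit.
Unset Printing Implicit Defensive.
Import Order.TTheory GRing.Theory Num.Theory.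
Import numFieldNormedType.Exports.
Local Open Scope classical_set_scope.
Local Open Scope ereal_scope.

(** * Separation in completely regular spaces *)

(** The neighbourhoods of the ambient space restrict to the subspace, so it suffices to separate the
    points of [A] in [X]. This form suits the weak topology, where only positive Radon measures get
    separated below. *)
Lemma hausdorff_set_type (X : topologicalType) (A : set X) :
  (forall x y, A x -> A y -> cluster (nbhs x) y -> x = y) ->
  hausdorff_space (set_type A).
Proof.
move=> hA x y xy; apply/val_inj/hA; [exact: set_valP|exact: set_valP|].
move=> U V xU yV.
have vx := @initial_continuous A X set_val x.
have vy := @initial_continuous A X set_val y.
by have [z [Uz Vz]] := xy _ _ (vx _ xU) (vy _ yV); exists (set_val z).
Qed.

(** Each point [a] of [K] has a function [h a] vanishing at [a] and equal to 1 off [U]. Finitely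
    many of the sets where [h a < 1/2] cover [K], and the product of the corresponding [h a] is
    below 1/2 on [K] and still 1 off [U]; an affine change and a truncation finish. *)
Lemma compact_completely_regular (R : realType) (T : ptopologicalType)
    (K U : set T) :
  completely_regular_space T -> compact K -> open U -> K `<=` U ->
  exists f : T -> R, [/\ continuous f, forall x, (0 <= f x <= 1)%R,
    forall x, K x -> f x = 1%R & forall x, ~ U x -> f x = 0%R].
Proof.
move=> /(completely_regularP R) crT cK oU KU.
have /choice[h hP] (a : T) : exists f : T -> R, K a -> [/\ continuous f,
    forall x, (0 <= f x <= 1)%R, f a = 0%R & forall x, ~ U x -> f x = 1%R].
  have [Ka|] := pselect (K a); last by exists (cst 0%R).
  have [||f [cf f01 fa fU]] := crT a (~` U); first exact: open_closedC.
    by apply; exact: KU.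
  exists f => _; split => // x.
  by have := f01 (f x); rewrite /= in_itv/=; apply; exists x.
pose V a := h a @^-1` [set y | (y < 2^-1)%R].
have [D DK KD] : finite_subset_cover K V K.
  move: cK; rewrite compact_cover => cK.
  apply: cK => [a Ka|x Kx].
    apply: open_comp => [y _|]; last exact: open_lt.
    by have [+ _ _ _] := hP _ Ka; exact.
  by exists x => //; rewrite /V/=; have [_ _ -> _] := hP _ Kx; rewrite invr_gt0.
(* [g] is the product of the [h a] for [a] in [D], built by induction on the list. As all factors
   lie in [0, 1], one factor below 1/2 suffices. *)
have [g [cg g01 gD gU]] : exists g : T -> R, [/\ continuous g,
    forall x, (0 <= g x <= 1)%R,
    forall x, (exists2 a, a \in (D : seq T) & V a x) -> (g x < 2^-1)%R
    & forall x, ~ U x -> g x = 1%R].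
  have : {subset (D : seq T) <= K} by move=> a /DK.
  move: (D : seq T) => s; elim: s=> [_|a s IH sK].
    exists (cst 1%R); split=> [|x|x []|] //; first exact: cst_continuous.
    by rewrite /= ler01 lexx.
  have [|g [cg g01 gs gU]] := IH.
    by move=> b bs; apply: sK; rewrite inE bs orbT.
  have /set_mem Ka := sK _ (mem_head a s).
  have [ch h01 _ hU] := hP _ Ka.
  exists (h a \* g)%R; split.
  - by move=> x; apply: continuousM; [exact: ch|exact: cg].
  - move=> x /=; have /andP[? ?] := h01 x; have /andP[? ?] := g01 x.
    by rewrite mulr_ge0//= mulr_ile1.
  - move=> x [b + Vb]; have /andP[? ?] := h01 x; have /andP[? ?] := g01 x.
    rewrite inE => /predU1P[ba|bs].
      by rewrite (le_lt_trans _ Vb)// ba ler_piMr.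
    have /gs : exists2 b, b \in s & V b x by exists b.
    by apply: le_lt_trans; rewrite /= ler_piMl.
  - by move=> x Ux /=; rewrite hU// gU// mulr1.
(* Where [g < 1/2] the second term exceeds 1, so the minimum is 1; where [g = 1] it is 0. *)
exists ((cst 1 : T -> R) \min (fun x => 2 * (1 - g x)))%R; split.
- move=> x; apply: continuous_min; first exact: cst_continuous.
  by apply: cvgM; [exact: cvg_cst|apply: cvgB; [exact: cvg_cst|exact: cg]].
- move=> x; have /andP[? ?] := g01 x.
  by rewrite /= le_min ler01/= ge_min lexx/= mulr_ge0// subr_ge0.
- move=> x Kx; apply/min_idPl.
  have /gD : exists2 a, a \in (D : seq T) & V a x.
    by have [a ? ?] := KD _ Kx; exists a.
  by rewrite /cst /= => ?; lra.
- by move=> x Ux; rewrite /= gU// subrr mulr0; apply/min_idPr.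
Qed.

(** [L] is closed, so a continuous function is 1 on [K] and 0 on [L]; cut it at 1/2. *)
Lemma compact_disjoint_separated (R : realType) (T : ptopologicalType)
    (K L : set T) :
  tychonoff_space T -> compact K -> compact L -> K `&` L = set0 ->
  exists U V : set T,
    [/\ open U, open V, K `<=` U, L `<=` V & U `&` V = set0].
Proof.
move=> [crT hT] cK cL KL.
have [||f [cf _ fK fL]] := @compact_completely_regular R T K (~` L) crT cK.
- by apply/closed_openC; exact: compact_closed.
- exact/disjoints_subset.
exists (f @^-1` [set y | (2^-1 < y)%R]), (f @^-1` [set y | (y < 2^-1)%R]).
split.
- by apply: open_comp => [y _|]; [exact: cf|exact: open_gt].
- by apply: open_comp => [y _|]; [exact: cf|exact: open_lt].
- by move=> x /fK /= ->; rewrite invf_lt1// ltr1n.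
- by move=> x Lx /=; rewrite fL ?invr_gt0//; exact.
- by rewrite -subset0 => x [/= /lt_trans/[apply]]; rewrite ltxx.
Qed.

(** * Borel measurability of topological objects *)

Section borel_sets.
Context (T : ptopologicalType).

Lemma open_borel (U : set T) : open U -> measurable (U : set (borel T)).
Proof. exact: sub_sigma_algebra. Qed.

Lemma closed_borel (C : set T) : closed C -> measurable (C : set (borel T)).
Proof.
move=> cC; rewrite -(setCK C); apply: measurableC; apply: open_borel.
exact: closed_openC.
Qed.

Lemma compact_borel (K : set T) : hausdorff_space T -> compact K ->
  measurable (K : set (borel T)).
Proof. by move=> hT cK; apply: closed_borel; exact: compact_closed. Qed.

Lemma continuous_borel_measurable (R : realType) (f : T -> R) :
  continuous f -> measurable_fun setT (f : borel T -> R).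
Proof.
move=> /continuousP cf.
apply: (measurability _ (measurable_realfun.RGenOpens.measurableE R)).
move=> _ [_ [a [b ->]] <-]; rewrite setTI.
by apply: open_borel; apply: cf; exact: interval_open.
Qed.

End borel_sets.

(** * The Radon measure generated by a content on open sets *)

Section radon_extension.
Context (R : realType) (T : ptopologicalType) (m : set T -> \bar R).
Hypotheses (hT : tychonoff_space T) (m0 : m set0 = 0)
  (m_ge0 : forall U, open U -> 0 <= m U) (m_fin : m setT < +oo)
  (m_le : forall U V, open U -> open V -> U `<=` V -> m U <= m V)
  (m_leU : forall U V, open U -> open V -> m (U `|` V) <= m U + m V)
  (m_geU : forall U V, open U -> open V -> U `&` V = set0 ->
    m U + m V <= m (U `|` V)).
Implicit Types K L U V G A : set T.

Definition outer_content K :=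
  ereal_inf [set m U | U in [set U | open U /\ K `<=` U]].

Local Notation cap := outer_content.

Lemma outer_content_le K U : open U -> K `<=` U -> cap K <= m U.
Proof. by move=> oU KU; apply: ereal_inf_lbound; exists U. Qed.

Lemma outer_content_ge K (a : \bar R) :
  (forall U, open U -> K `<=` U -> a <= m U) -> a <= cap K.
Proof. by move=> h; apply: le_ereal_inf_tmp => _ [U [oU KU] <-]; exact: h. Qed.

Lemma outer_content_ge0 K : 0 <= cap K.
Proof. by apply: outer_content_ge => U oU _; exact: m_ge0. Qed.

Lemma outer_content_fin_num K : cap K \is a fin_num.
Proof.
rewrite ge0_fin_numE ?outer_content_ge0//.
by rewrite (le_lt_trans _ m_fin)//; apply: outer_content_le => //; exact: openT.
Qed.

Lemma outer_content_adherent K (e : R) : (0 < e)%R ->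
  exists U, [/\ open U, K `<=` U & m U < cap K + e%:E].
Proof.
move=> /lb_ereal_inf_adherent /(_ (outer_content_fin_num K)).
by move=> [_ [U [oU KU] <-] mU]; exists U.
Qed.

Lemma le_outer_content K L : K `<=` L -> cap K <= cap L.
Proof.
move=> KL; apply: outer_content_ge => U oU LU.
by apply: outer_content_le => //; exact: subset_trans LU.
Qed.

Lemma outer_contentU K L : cap (K `|` L) <= cap K + cap L.
Proof.
apply/lee_addgt0Pr => e e0; have e20 : (0 < e / 2)%R by rewrite divr_gt0.
have [U [oU KU mU]] := outer_content_adherent K e20.
have [V [oV LV mV]] := outer_content_adherent L e20.
rewrite (splitr e) EFinD addeACA.
apply: le_trans (leeD (ltW mU) (ltW mV)).
apply: le_trans (m_leU oU oV).
by apply: outer_content_le; [exact: openU|exact: setUSS].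
Qed.

(** Disjoint open sets [U] and [V] around [K] and [L] cut any open [W] containing both into disjoint
    open pieces, on which [m] is superadditive. *)
Lemma outer_contentU_disjoint K L : compact K -> compact L ->
  K `&` L = set0 -> cap K + cap L <= cap (K `|` L).
Proof.
move=> cK cL KL; apply: outer_content_ge => W oW; rewrite subUset => -[KW LW].
have [U [V [oU oV KU LV UV]]] :=
  @compact_disjoint_separated R T K L hT cK cL KL.
have oUW := openI oU oW; have oVW := openI oV oW.
apply: (@le_trans _ _ (m (U `&` W) + m (V `&` W))).
  by apply: leeD; apply: outer_content_le => //; rewrite subsetI.
apply: (@le_trans _ _ (m ((U `&` W) `|` (V `&` W)))).
  by apply: m_geU => //; rewrite setIACA UV set0I.
apply: m_le => //; first exact: openU.
by rewrite -setIUl; exact: subIsetr.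
Qed.

(** For open [G] this may be strictly below [m G], since no regularity of [m] is assumed. Passing
    through compacts buys countable subadditivity on open sets, which [m] itself may lack. *)
Definition inner_content G :=
  ereal_sup [set cap K | K in [set K | compact K /\ K `<=` G]].

Local Notation inn := inner_content.

Lemma inner_content_ge K G : compact K -> K `<=` G -> cap K <= inn G.
Proof. by move=> cK KG; apply: ereal_sup_ubound; exists K. Qed.

Lemma inner_content_le G (a : \bar R) :
  (forall K, compact K -> K `<=` G -> cap K <= a) -> inn G <= a.
Proof. by move=> h; apply: ge_ereal_sup => _ [K [cK KG] <-]; exact: h. Qed.

Lemma le_inner_content G U : G `<=` U -> inn G <= inn U.
Proof.
move=> GU; apply: inner_content_le => K cK KG.
by apply: inner_content_ge => //; exact: subset_trans GU.
Qed.

Lemma inner_content_ge0 G : 0 <= inn G.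
Proof.
apply: le_trans (outer_content_ge0 set0) _.
by apply: inner_content_ge => //; exact: compact0.
Qed.

Lemma inner_content_le_open G U : open U -> G `<=` U -> inn G <= m U.
Proof.
move=> oU GU; apply: inner_content_le => K cK KG.
by apply: outer_content_le => //; exact: subset_trans GU.
Qed.

Lemma inner_content_fin_num G : inn G \is a fin_num.
Proof.
rewrite ge0_fin_numE ?inner_content_ge0// (le_lt_trans _ m_fin)//.
by apply: inner_content_le_open => //; exact: openT.
Qed.

Lemma inner_content0 : inn set0 = 0.
Proof.
apply/eqP; rewrite eq_le inner_content_ge0 andbT -m0.
by apply: inner_content_le_open => //; exact: open0.
Qed.

Lemma inner_content_adherent G (e : R) : (0 < e)%R ->
  exists K, [/\ compact K, K `<=` G & inn G <= cap K + e%:E].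
Proof.
move=> /ub_ereal_sup_adherent /(_ (inner_content_fin_num G)).
move=> [_ [K [cK KG] <-] GK]; exists K; split => //.
by rewrite -leeBlDr// ltW.
Qed.

(* A compact [K] in [G `|` U] splits as [(K `\` V) `|` (K `\` W)], where [V] and
   [W] separate [K `\` G] from [K `\` U]. *)
Lemma inner_contentU G U : open G -> open U -> inn (G `|` U) <= inn G + inn U.
Proof.
move=> oG oU; apply: inner_content_le => K cK KGU.
have cG : compact (K `\` G) by apply: compact_closedI => //; exact: open_closedC.
have cU : compact (K `\` U) by apply: compact_closedI => //; exact: open_closedC.
have [|V [W [oV oW GV UW VW]]] := @compact_disjoint_separated R T _ _ hT cG cU.
  by rewrite -subset0 => x [[Kx nGx] [_ nUx]]; have [] := KGU _ Kx.
apply: (@le_trans _ _ (cap (K `\` V) + cap (K `\` W))).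
  apply: le_trans (outer_contentU _ _); apply: le_outer_content.
  by rewrite -setDIr VW setD0.
apply: leeD; apply: inner_content_ge.
- by apply: compact_closedI => //; exact: open_closedC.
- by move=> x [Kx nVx]; apply: contrapT => nGx; apply: nVx; exact: GV.
- by apply: compact_closedI => //; exact: open_closedC.
- by move=> x [Kx nWx]; apply: contrapT => nUx; apply: nWx; exact: UW.
Qed.

Lemma inner_content_bigsetU (G : (set T)^nat) n : (forall i, open (G i)) ->
  inn (\big[setU/set0]_(i < n) G i) <= \sum_(0 <= i < n) inn (G i).
Proof.
move=> oG; elim: n => [|n IH]; first by rewrite big_ord0 inner_content0 big_nil.
rewrite big_ord_recr big_nat_recr//=.
apply: le_trans (leeD2r _ IH); apply: inner_contentU => //.
by rewrite -bigcup_mkord; exact: bigcup_open.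
Qed.

(** A compact subset of the union already lies in a finite union, so finite subadditivity is
    enough. *)
Lemma inner_content_bigcup (G : (set T)^nat) : (forall i, open (G i)) ->
  inn (\bigcup_i G i) <= \sum_(0 <= i <oo) inn (G i).
Proof.
move=> oG; apply: inner_content_le => K; rewrite compact_cover => cK KG.
have [//|D _ KD] := cK nat setT G (fun i _ => oG i).
(* [n] exceeds every index of the finite subcover, so the initial segment of length [n] covers
   [K]. *)
pose n := (\max_(i <- (D : seq nat)) i).+1.
apply: (@le_trans _ _ (\sum_(0 <= i < n) inn (G i))); last first.
  by apply: nneseries_lim_ge => i _ _; exact: inner_content_ge0.
apply: le_trans (inner_content_bigsetU n oG).
apply: inner_content_ge; first by rewrite compact_cover.
move=> x /KD[i /= iD Gix]; rewrite -bigcup_mkord; exists i => //=.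
by rewrite /n ltnS; exact: (@leq_bigmax_seq _ _ xpredT id).
Qed.

Definition content_outer A :=
  ereal_inf [set inn G | G in [set G | open G /\ A `<=` G]].

Local Notation out := content_outer.

Lemma content_outer_le A G : open G -> A `<=` G -> out A <= inn G.
Proof. by move=> oG AG; apply: ereal_inf_lbound; exists G. Qed.

Lemma content_outer_ge A (a : \bar R) :
  (forall G, open G -> A `<=` G -> a <= inn G) -> a <= out A.
Proof. by move=> h; apply: le_ereal_inf_tmp => _ [U [oU KU] <-]; exact: h. Qed.

Lemma content_outer_open G : open G -> out G = inn G.
Proof.
move=> oG; apply/eqP; rewrite eq_le content_outer_le//=.
by apply: content_outer_ge => U oU; exact: le_inner_content.
Qed.

Let content_outer0 : out set0 = 0.
Proof. by rewrite content_outer_open ?inner_content0//; exact: open0. Qed.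

Let content_outer_ge0 A : 0 <= out A.
Proof. by apply: content_outer_ge => G oG _; exact: inner_content_ge0. Qed.

Lemma content_outer_fin_num A : out A \is a fin_num.
Proof.
rewrite ge0_fin_numE ?content_outer_ge0//.
apply: (@le_lt_trans _ _ (inn setT)).
  by apply: content_outer_le => //; exact: openT.
by have := inner_content_fin_num setT; rewrite ge0_fin_numE// inner_content_ge0.
Qed.

Lemma content_outer_adherent A (e : R) : (0 < e)%R ->
  exists G, [/\ open G, A `<=` G & inn G < out A + e%:E].
Proof.
move=> /lb_ereal_inf_adherent /(_ (content_outer_fin_num A)).
by move=> [_ [U [oU KU] <-] mU]; exists U.
Qed.

Let le_content_outer : {homo out : A B / A `<=` B >-> A <= B}.
Proof.
move=> A B AB; apply: content_outer_ge => G oG BG.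
by apply: content_outer_le => //; exact: subset_trans BG.
Qed.

Let content_outer_sigma_subadditive : sigma_subadditive out.
Proof.
move=> A; apply/lee_addgt0Pr => e e0.
have e2 n : (0 < e / (2 ^ n.+1)%:R)%R by rewrite divr_gt0// ltr0n expn_gt0.
have /choice[G hG] := fun n => content_outer_adherent (A n) (e2 n).
apply: le_trans (epsilon_trick xpredT _ (ltW e0)); last first.
  by move=> n; exact: content_outer_ge0.
apply: (@le_trans _ _ (inn (\bigcup_n G n))).
  apply: content_outer_le; first by apply: bigcup_open => n _; case: (hG n).
  by apply: subset_bigcup => n _; case: (hG n).
have oG n : open (G n) by case: (hG n).
apply: le_trans (inner_content_bigcup oG) _.
apply: lee_nneseries => n *; first exact: inner_content_ge0.
by case: (hG n) => _ _ /ltW.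
Qed.

HB.instance Definition _ := isOuterMeasure.Build R T out content_outer0
  content_outer_ge0 le_content_outer content_outer_sigma_subadditive.

(* For [X `<=` O] open, fill [O `&` G] by a compact [K] and then [O `\` K] by a
   compact [L]: [outer_content] is additive on the disjoint pair [K], [L]. *)
Lemma open_caratheodory G : open G -> out.-caratheodory G.
Proof.
move=> oG; apply: le_caratheodory_measurable => X.
apply: content_outer_ge => O oO XO; apply/lee_addgt0Pr => e e0.
have e20 : (0 < e / 2)%R by rewrite divr_gt0.
have [K [cK KOG hK]] := inner_content_adherent (O `&` G) e20.
have [L [cL LOK hL]] := inner_content_adherent (O `\` K) e20.
have oOK : open (O `\` K).
  apply: openI => //; apply: closed_openC.
  by apply: compact_closed cK; case: hT.
apply: (@le_trans _ _ (inn (O `&` G) + inn (O `\` K))).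
  apply: leeD; apply: content_outer_le => //; first exact: openI.
    by apply: setISS.
  by apply: setISS => //; apply: subsetC => x /KOG[].
apply: le_trans (leeD hK hL) _.
rewrite addeACA -EFinD -splitr leeD2r//.
apply: (@le_trans _ _ (cap (K `|` L))).
  apply: outer_contentU_disjoint => //.
  by rewrite -subset0 => x [Kx /LOK[]].
apply: inner_content_ge; first exact: compactU.
by rewrite subUset; split=> x; [move=> /KOG[]|move=> /LOK[]].
Qed.

Lemma borel_caratheodory (A : set (borel T)) :
  measurable A -> out.-caratheodory A.
Proof.
apply: smallest_sub; last by move=> G; exact: open_caratheodory.
split; first exact: caratheodory_measurable_set0.
- by move=> B; rewrite setTD; exact: caratheodory_measurable_setC.
- by move=> F; exact: caratheodory_measurable_bigcup.
Qed.

(** The outer measure is cut to 0 off the Borel sets, as [radon_out] demands. *)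
Definition content_charge (A : set (borel T)) : \bar R :=
  if `[< measurable A >] then out A else 0.

Lemma content_chargeE A : measurable (A : set (borel T)) ->
  content_charge A = out A.
Proof. by move=> mA; rewrite /content_charge asboolT. Qed.

Let content_charge0 : content_charge set0 = 0.
Proof. by rewrite content_chargeE//; exact: content_outer0. Qed.

Let content_charge_finite (A : set (borel T)) :
  measurable A -> content_charge A \is a fin_num.
Proof. by move=> mA; rewrite content_chargeE// content_outer_fin_num. Qed.

Let content_charge_sigma_additive : semi_sigma_additive content_charge.
Proof.
move=> F mF tF mUF; rewrite content_chargeE//.
under eq_fun do under eq_bigr do rewrite content_chargeE//.
apply: (@caratheodory_measure_sigma_additive R T out) => //.
- by move=> i; exact/borel_caratheodory.
- exact/borel_caratheodory.
Qed.

HB.instance Definition _ := isCharge.Build _ (borel T) R content_charge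
  content_charge0 content_charge_finite content_charge_sigma_additive.


Lemma outer_content_le_outer K : compact K -> cap K <= out K.
Proof.
by move=> cK; apply: content_outer_ge => G oG; exact: inner_content_ge.
Qed.

(** Take a compact [K] carrying almost all the mass and an open [G] containing [~]
    B[with little excess. Then]K [\]
    G[is a compact subset of]B[, and what it misses of]B[lies in the union of]~[K] and [G]&[B], each
    of measure at most [e / 4]. *)
Lemma content_charge_inner (B : set (borel T)) : measurable B ->
  forall e : R, (0 < e)%R -> exists2 C : set T,
    compact_hausdorff C /\ C `<=` B &
    `|content_charge B - content_charge C| < e%:E.
Proof.
move=> mB e e0; have e20 : (0 < e / 2 / 2)%R by rewrite !divr_gt0.
have [_ hdT] := hT.
have [K [cK _ hK]] := inner_content_adherent setT e20.
have [G [oG BG hG]] := content_outer_adherent (~` B) e20.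
have cKG : compact (K `\` G).
  by apply: compact_closedI => //; exact: open_closedC.
have KGB : K `\` G `<=` B.
  by move=> x [_]; apply: contra_notP; exact: BG.
exists (K `\` G).
  split=> //; split; last by rewrite -compact_cover.
  by apply: hausdorff_set_type => x y _ _; exact: hdT.
have mK := compact_borel hdT cK; have mKG := compact_borel hdT cKG.
(* Three Caratheodory splittings, along [K]\[G], [K] and [B], turn the approximation estimates into
   bounds on the remainders. *)
have hB : out B = out (K `\` G) + out (B `&` ~` (K `\` G)).
  by have /borel_caratheodory/(_ B) := mKG; rewrite (setIidr KGB).
have KE : out setT = out K + out (~` K).
  by have /borel_caratheodory/(_ setT) := mK; rewrite !setTI.
have GE : out G = out (G `&` B) + out (~` B).
  by have /borel_caratheodory/(_ G) := mB; rewrite (setIidr BG).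
have out_nK : out (~` K) <= (e / 2 / 2)%:E.
  have := le_trans hK (leeD2r _ (outer_content_le_outer cK)).
  rewrite -(content_outer_open openT) KE leeD2lE//.
  exact: content_outer_fin_num.
have out_GB : out (G `&` B) <= (e / 2 / 2)%:E.
  move: hG; rewrite -(content_outer_open oG) GE addeC => /ltW.
  by rewrite leeD2lE// content_outer_fin_num.
have out_D : out (B `&` ~` (K `\` G)) <= (e / 2)%:E.
  rewrite (splitr (e / 2)) EFinD; apply: le_trans (leeD out_nK out_GB).
  apply: le_trans (outer_measureU2 out _ _); apply: le_outer_measure => x [Bx nKG].
  have [Kx|] := pselect (K x); last by left.
  by right; split=> //; apply: contrapT => nGx; exact: nKG.
rewrite !content_chargeE// hB (addeC (out (K `\` G))) addeK ?content_outer_fin_num//.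
rewrite gee0_abs ?outer_measure_ge0// (le_lt_trans out_D)// lte_fin.
by rewrite ltr_pdivrMr// ltr_pMr// ltr1n.
Qed.

Lemma content_charge_out (A : set (borel T)) :
  ~ measurable A -> content_charge A = 0.
Proof. by move=> mA; rewrite /content_charge asboolF. Qed.

Definition content_radon : radon_measure R T :=
  @RadonMeasure R T content_charge content_charge_out content_charge_inner.

Lemma content_radon_ge0 : radon_ge0 content_radon.
Proof. by move=> B mB /=; rewrite content_chargeE// outer_measure_ge0. Qed.

Lemma content_radon_open_le G : open G -> content_radon G <= m G.
Proof.
move=> oG; rewrite /= content_chargeE; last exact: open_borel.
by rewrite content_outer_open// inner_content_le_open.
Qed.

(** With positivity and the upper bound [content_radon_open_le], this lower bound is all that the
    limit argument uses about the generated measure. *)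
Lemma content_radon_compact_ge K (a : \bar R) : compact K ->
  (forall U, open U -> K `<=` U -> a <= m U) -> a <= content_radon K.
Proof.
move=> cK aK; rewrite /= content_chargeE; last by apply: compact_borel cK; case: hT.
exact: le_trans (outer_content_ge aK) (outer_content_le_outer cK).
Qed.

End radon_extension.

(** * Integration against charges and the weak topology *)

Lemma bounded_continuous_bound (R : realType) (T : ptopologicalType)
    (f : T -> R) : bounded_continuous f ->
  exists2 M : R, (0 < M)%R & forall y, (`|f y| <= M)%R.
Proof.
by move=> [_ /pinfty_ex_gt0[M M0 fM]]; exists M => // y; exact: fM.
Qed.

Lemma bounded_continuous01 (R : realType) (T : ptopologicalType) (f : T -> R) :
  continuous f -> (forall x, 0 <= f x <= 1)%R -> bounded_continuous f.
Proof.
move=> cf f01; split=> //; exists 1%R; split=> [//|M M1 x _] /=.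
by have /andP[? ?] := f01 x; rewrite ger0_norm// (le_trans _ (ltW M1)).
Qed.

Lemma Rintegral_measure_add d (S : measurableType d) (R : realType)
    (m1 m2 : {measure set S -> \bar R}%R) (f : S -> R) :
  m1.-integrable setT (EFin \o f) -> m2.-integrable setT (EFin \o f) ->
  (\int[measure_add m1 m2]_x f x = \int[m1]_x f x + \int[m2]_x f x)%R.
Proof.
move=> if1 if2; rewrite /Rintegral integral_measure_add//.
by rewrite fineD//; exact: integrable_fin_num.
Qed.

(** The Jordan parts of [la = nu - mu] are not the differences of those of [nu] and [mu]. Moving the
    negative terms across gives instead [la^+ + nu^- + mu^+ = la^- + nu^+ + mu^-], an identity of
    positive measures, and integration is additive in these. *)
Lemma charge_intB d (S : measurableType d) (R : realType)
    (nu mu : {charge set S -> \bar R}%R) (f : S -> R) :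
  measurable_fun setT f -> bounded_fun f ->
  charge_int (cadd nu (copp mu)) f = (charge_int nu f - charge_int mu f)%R.
Proof.
move=> mf bf.
have intf (m : {finite_measure set S -> \bar R}%R) :
    m.-integrable setT (EFin \o f).
  by apply: measurable_bounded_integrable => //; exact: fin_num_fun_lty.
have addE (m1 m2 : {measure set S -> \bar R}%R) A :
    (measure_add m1 m2 : {measure set S -> \bar R}%R) A = m1 A + m2 A.
  exact: measure_addE.
pose la : {charge set S -> \bar R}%R := cadd nu (copp mu).
rewrite -[LHS]/(charge_int la f) /charge_int.
have : (\int[measure_add (charge_pos la)
    (measure_add (charge_neg nu) (charge_pos mu))]_x f x =
  \int[measure_add (charge_neg la)
    (measure_add (charge_pos nu) (charge_neg mu))]_x f x)%R.
  congr fine; apply: eq_measure_integral => A mA _.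
  rewrite !addE; suff : charge_pos la A + (charge_neg nu A + charge_pos mu A) =
    charge_neg la A + (charge_pos nu A + charge_neg mu A) by [].
  have : nu A - mu A = charge_pos la A - charge_neg la A := charge_decomp la mA.
  rewrite (charge_decomp nu mA) (charge_decomp mu mA).
  have fin (m : {finite_measure set S -> \bar R}%R) := fin_num_measure m A mA.
  move: (fin (charge_pos la)) (fin (charge_neg la)) (fin (charge_pos nu))
    (fin (charge_neg nu)) (fin (charge_pos mu)) (fin (charge_neg mu)).
  (* All six values are finite, so the identity becomes linear arithmetic over [R]. *)
  do 6 (move=> /fineK <-); rewrite -!EFinB -!EFinD => -[h].
  by congr EFin; lra.
have intD (m1 m2 : {finite_measure set S -> \bar R}%R) :
    (measure_add m1 m2).-integrable setT (EFin \o f).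
  apply: measurable_bounded_integrable => //.
  by rewrite addE lte_add_pinfty//; exact: fin_num_fun_lty.
rewrite !Rintegral_measure_add; try by [exact: intf|exact: intD].
by move=> ?; lra.
Qed.

Section nonnegative_radon.
Context (R : realType) (T : ptopologicalType).
Implicit Types (mu nu : radon_measure R T) (f : T -> R).

Lemma bounded_continuous_integrable
    (m : {finite_measure set (borel T) -> \bar R}%R) f :
  bounded_continuous f -> m.-integrable setT (EFin \o f).
Proof.
move=> [cf bf]; apply: measurable_bounded_integrable => //.
  exact: fin_num_fun_lty.
exact: continuous_borel_measurable.
Qed.

Lemma radon_posE mu (A : set (borel T)) : radon_ge0 mu -> measurable A ->
  charge_pos mu A = mu A.
Proof.
move=> mu0 mA; apply/eqP; rewrite eq_le charge_pos_ub// andbT.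
exact: charge_pos_lub.
Qed.

Lemma radon_ge0_charge_int mu f : radon_ge0 mu ->
  charge_int mu f = (\int[charge_pos mu]_x f x)%R.
Proof.
move=> mu0; rewrite /charge_int [X in (_ - X)%R](_ : _ = 0%R) ?subr0//.
rewrite /Rintegral (eq_measure_integral mzero) ?integral_measure_zero//.
move=> A mA _; have := charge_decomp mu mA.
rewrite radon_posE// => h; suff : charge_neg mu A = 0 by [].
move: (fin_num_measure mu A mA) (fin_num_measure (charge_neg mu) A mA) h.
by move=> /fineK <- /fineK <-; rewrite -EFinB => -[h]; congr EFin; lra.
Qed.

End nonnegative_radon.

Lemma Rintegral_indic d (S : measurableType d) (R : realType)
    (m : {measure set S -> \bar R}%R) (A : set S) : measurable A ->
  (\int[m]_x \1_A x = fine (m A))%R.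
Proof. by move=> mA; rewrite /Rintegral integral_indic// setIT. Qed.

Section weak_topology.
Context (R : realType) (T : ptopologicalType).
Implicit Types (mu nu : radon_measure R T) (f : T -> R).

Lemma weak_distE f nu mu : bounded_continuous f ->
  weak_dist f nu mu = `|charge_int nu f - charge_int mu f|%R.
Proof.
move=> [cf bf]; rewrite /weak_dist charge_intB//.
exact: continuous_borel_measurable.
Qed.

Lemma nbhs_weak_dist f mu (e : R) : bounded_continuous f -> (0 < e)%R ->
  nbhs mu [set nu | (weak_dist f nu mu < e)%R].
Proof.
move=> bf e0; apply: open_nbhs_nbhs; split; last first.
  by rewrite /= weak_distE// subrr normr0.
suff : weak_open [set nu | (weak_dist f nu mu < e)%R] by [].
move=> nu /= nue; exists [:: f], (e - weak_dist f nu mu)%R; split.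
- by rewrite subr_gt0.
- by move=> g; rewrite inE => /eqP ->.
- move=> la /(_ f (mem_head _ _)); rewrite /= ltrBrDr; apply: le_lt_trans.
  by rewrite !weak_distE// ler_distD.
Qed.

Lemma le_radon mu (A B : set (borel T)) : radon_ge0 mu ->
  measurable A -> measurable B -> A `<=` B -> mu A <= mu B.
Proof.
move=> mu0 mA mB AB; rewrite -!radon_posE//.
by apply: le_measure => //; exact: mem_set.
Qed.

Lemma radon_outer mu (K : set (borel T)) (e : R) : hausdorff_space T ->
  measurable K -> (0 < e)%R ->
  exists U : set T, [/\ open U, K `<=` U & mu U < mu K + e%:E].
Proof.
move=> hT mK e0; have mKC := measurableC mK.
have [C [[_ cC] CK] hC] := radon_inner mu mKC e0.
have {}cC : closed C by apply: compact_closed => //; rewrite compact_cover.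
exists (~` C); split; first exact: closed_openC.
  by move=> x Kx /CK.
have mC := closed_borel cC.
have muC (A : set (borel T)) : measurable A -> mu (~` A) = mu setT - mu A.
  move=> mA; have := chargeDI mu measurableT mA.
  by rewrite setTD setTI => ->; rewrite addeK// fin_num_measure.
move: hC; rewrite !muC//.
move: (fin_num_measure mu _ (@measurableT _ (borel T))) (fin_num_measure mu _ mK)
  (fin_num_measure mu _ mC).
move=> /fineK <- /fineK <- /fineK <-.
rewrite -!EFinB -EFinD abse_EFin !lte_fin => /ltr_normlW; lra.
Qed.

(** For an open [U] around [K] with [nu U < nu K + e] and a continuous [f] between the indicators of
    [K] and [U], [mu K <= \int f dmu = \int f dnu <= nu U]. *)
Lemma compact_radon_le mu nu (K : set T) : tychonoff_space T ->
  radon_ge0 mu -> radon_ge0 nu ->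
  (forall f, bounded_continuous f -> charge_int mu f = charge_int nu f) ->
  compact K -> mu K <= nu K.
Proof.
move=> [crT hT] mu0 nu0 munu cK; apply/lee_addgt0Pr => e e0.
have mK := compact_borel hT cK.
have [U [oU KU hU]] := radon_outer nu hT mK e0; apply: le_trans (ltW hU).
have [f [cf f01 fK fU]] := @compact_completely_regular R T K U crT cK oU KU.
have bcf := bounded_continuous01 cf f01.
have mU := open_borel oU; rewrite -(radon_posE mu0 mK) -(radon_posE nu0 mU).
rewrite -(fineK (fin_num_measure (charge_pos mu) _ mK)).
rewrite -(fineK (fin_num_measure (charge_pos nu) _ mU)).
rewrite lee_fin -!Rintegral_indic//.
apply: (@le_trans _ _ (\int[charge_pos mu]_x f x)%R).
  apply: le_Rintegral => //; first exact: integrable_indic.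
  - exact: bounded_continuous_integrable.
  - move=> x _; rewrite indicE; case: (boolP (x \in K)) => [/set_mem/fK ->//|_].
    by case/andP: (f01 x).
rewrite -radon_ge0_charge_int// munu// radon_ge0_charge_int//.
apply: le_Rintegral => //; first exact: bounded_continuous_integrable.
- exact: integrable_indic.
- move=> x _; rewrite indicE.
  have [xU|/fU ->] := pselect (U x); last by case: (_ \in _).
  by rewrite mem_set//=; case/andP: (f01 x).
Qed.

(** Inner regularity of [mu] reduces the comparison to compact subsets of [B]. *)
Lemma radon_le mu nu (B : set (borel T)) : tychonoff_space T ->
  radon_ge0 mu -> radon_ge0 nu ->
  (forall f, bounded_continuous f -> charge_int mu f = charge_int nu f) ->
  measurable B -> mu B <= nu B.
Proof.
move=> tT mu0 nu0 munu mB; apply/lee_addgt0Pr => e e0.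
have [C [[_ cC] CB] hC] := radon_inner mu mB e0.
have {}cC : compact C by rewrite compact_cover.
have mC : measurable (C : set (borel T)).
  by apply: compact_borel cC; case: tT.
apply: (@le_trans _ _ (mu C + e%:E)).
  rewrite -leeBlDl ?fin_num_measure//; apply: le_trans (ltW hC).
  exact: lee_abs.
apply: leeD2r; apply: le_trans (compact_radon_le tT mu0 nu0 munu cC) _.
exact: le_radon.
Qed.

(** The normalization [radon_out] extends the equality to all subsets; the remaining fields are
    proofs, identified by proof irrelevance. *)
Lemma eq_radon mu nu :
  (forall B : set (borel T), measurable B -> mu B = nu B) -> mu = nu.
Proof.
move=> munu.
have : (mu : set (borel T) -> \bar R) = nu.
  apply/funext => B; have [/munu//|nB] := pselect (measurable B).
  by rewrite !radon_out.
move: mu nu {munu} => [[m [[m1] [m2] [m3]]] o i] [[n [[n1] [n2] [n3]]] o' i'] /= mn.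
case: _ / mn in n1 n2 n3 o' i' *.
rewrite (Prop_irrelevance n1 m1) (Prop_irrelevance n2 m2)
  (Prop_irrelevance n3 m3) in o' i' *.
by rewrite (Prop_irrelevance o' o) (Prop_irrelevance i' i).
Qed.

Lemma charge_int_inj mu nu : tychonoff_space T ->
  radon_ge0 mu -> radon_ge0 nu ->
  (forall f, bounded_continuous f -> charge_int mu f = charge_int nu f) ->
  mu = nu.
Proof.
move=> tT mu0 nu0 munu; apply: eq_radon => B mB; apply/eqP; rewrite eq_le.
by rewrite !radon_le// => f /munu.
Qed.

(** If [mu] and [nu] cannot be separated, their balls of radius [e / 2] for any [f] share a measure,
    so the integrals of [f] differ by at most [e]; integrals determine positive Radon measures. *)
Lemma radon_ge0_hausdorff (M : set (radon_measure R T)) : tychonoff_space T ->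
  M `<=` @radon_ge0 R T -> hausdorff_space (set_type M).
Proof.
move=> tT M0; apply: hausdorff_set_type => mu nu Mmu Mnu cl.
apply: charge_int_inj => //; [exact: M0|exact: M0|move=> f bf].
apply/eqP; rewrite -subr_eq0 -normr_le0; apply/ler_addgt0Pr => e e0.
have e20 : (0 < e / 2)%R by rewrite divr_gt0.
have [la []] := cl _ _ (nbhs_weak_dist mu bf e20) (nbhs_weak_dist nu bf e20).
rewrite /= !weak_distE// add0r => h1 h2.
rewrite (splitr e) (le_trans _ (ltW (ltrD h1 h2)))//.
by rewrite [X in (_ <= X + _)%R]distrC ler_distD.
Qed.

End weak_topology.

(** * Limits of tight ultrafilters *)

(** The image of [F] under [g] is an ultrafilter containing a compact segment. *)
Lemma ultra_cvg_bounded (X : Type) (R : realType) (F : set_system X)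
    (g : X -> R) (b : R) : UltraFilter F ->
  (\forall x \near F, (`|g x| <= b)%R) -> exists l : R, g x @[x --> F] --> l.
Proof.
move=> FU gb; have FP : ProperFilter F by exact: ultra_proper.
have GU : UltraFilter (fmap g F).
  split=> [|G GP FG]; first exact: fmap_proper_filter.
  apply/seteqP; split=> [A GA|]; last exact: FG.
  have [//|nA] := in_ultra_setVsetC (g @^-1` A) FU.
  have : G (A `&` ~` A) by apply: filterI => //; exact: FG.
  by rewrite setICr => /filter_ex[].
have : compact `[(- b)%R, b] by exact: segment_compact.
rewrite compact_ultra => /(_ _ GU)[|l [_ gl]]; last by exists l.
by apply: filterS gb => x /=; rewrite in_itv/= ler_norml.
Qed.

Lemma ler_cvg (X : Type) (R : realType) (F : set_system X) (f g : X -> R)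
    (l l' : R) : ProperFilter F ->
  f x @[x --> F] --> l -> g x @[x --> F] --> l' ->
  (\forall x \near F, (f x <= g x)%R) -> (l <= l')%R.
Proof.
move=> FP fl gl fg; rewrite -subr_ge0.
have h : (g x - f x)%R @[x --> F] --> (l' - l)%R by exact: cvgB.
rewrite -(cvg_lim _ h)//; apply: limr_ge; first by apply/cvg_ex; eexists; exact: h.
by apply: filterS fg => x; rewrite subr_ge0.
Qed.

(** For [z >= 0] the sum is the minimum of [n] and the ceiling of [z]. The first clause is there to
    carry the induction through the case [n < z]. *)
Lemma sum_indicator_lt (R : realType) (z : R) (n : nat) :
  let s := (\sum_(k < n) (k%:R < z)%R%:R)%R : R in
  [/\ (n%:R <= z -> s = n%:R)%R, (0 <= z -> z <= n%:R -> z <= s)%R &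
      (0 <= z -> s <= z + 1)%R].
Proof.
elim: n => [|n []]; first by rewrite /= big_ord0; split=> // *; lra.
set s := (\sum_(k < n) _)%R => h1 h2 h3.
rewrite /= big_ord_recr/= -/s -natr1.
case: (ltrP n%:R z) => nz; rewrite ?mulr1n ?mulr0n ?addr0; split.
- by move=> ?; rewrite h1// ltW.
- by move=> *; rewrite h1// ltW.
- by move=> *; rewrite h1 ?ltW//; lra.
- by move=> ?; lra.
- by move=> z0 _; exact: h2.
- by move=> z0; exact: h3.
Qed.

Lemma Rintegral_sum_indic d (S : measurableType d) (R : realType)
    (mu : {finite_measure set S -> \bar R}%R) (G : nat -> set S) (n : nat) :
  (forall k, measurable (G k)) ->
  mu.-integrable setT (EFin \o (fun x => \sum_(k < n) \1_(G k) x)%R) /\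
  (\int[mu]_x (\sum_(k < n) \1_(G k) x) = \sum_(k < n) fine (mu (G k)))%R.
Proof.
move=> mG.
have iG k : mu.-integrable setT (EFin \o indic (G k)) by exact: integrable_indic.
elim: n => [|n [IHi IH]].
  have -> : (fun x => \sum_(k < 0) \1_(G k) x)%R = cst (0 : R)%R.
    by apply/funext => x; rewrite big_ord0.
  by rewrite big_ord0 Rintegral_cst// mul0r; split => //; exact: integrable0.
have -> : (fun x => \sum_(k < n.+1) \1_(G k) x)%R =
    (fun x => \sum_(k < n) \1_(G k) x + \1_(G n) x : R)%R.
  by apply/funext => x; rewrite big_ord_recr.
rewrite big_ord_recr/= RintegralD// IH Rintegral_indic//; split=> //.
exact: (integrableD measurableT IHi (iG n)).
Qed.

Lemma open_layer (R : realType) (T : ptopologicalType) (f : T -> R) (n k : nat) :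
  continuous f -> (0 < n)%N -> open [set y | k%:R < n%:R * f y]%R.
Proof.
move=> cf n0; rewrite (_ : mkset _ = f @^-1` [set y | k%:R / n%:R < y]%R).
  by apply: open_comp => [y _|]; [exact: cf|exact: open_gt].
by apply/seteqP; split=> y /=; rewrite ltr_pdivrMr ?ltr0n// mulrC.
Qed.

(* [n^-1 * \sum_(k < n) \1_[set x | k < n * f x]] approximates [f] from above
   within [n^-1]. *)
Lemma Rintegral_layers (R : realType) (T : ptopologicalType)
    (mu : {finite_measure set (borel T) -> \bar R}%R) (f : T -> R) (n : nat) :
  continuous f -> (forall x, 0 <= f x <= 1)%R -> (0 < n)%N ->
  (\int[mu]_x f x <=
   n%:R^-1 * \sum_(k < n) fine (mu [set x | k%:R < n%:R * f x]) <=
   \int[mu]_x f x + n%:R^-1 * fine (mu setT))%R.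
Proof.
move=> cf f01 n0; set S := (_ * \sum_(_ < _) _)%R.
have n0R : (0 < n%:R :> R)%R by rewrite ltr0n.
have bcf := bounded_continuous01 cf f01.
pose G (k : nat) : set (borel T) := [set x | k%:R < n%:R * f x]%R.
have mG k : measurable (G k) by apply: open_borel; exact: open_layer.
have [iG IG] := Rintegral_sum_indic mu n mG.
have intf := bounded_continuous_integrable mu bcf.
have SE : S = (\int[mu]_x (n%:R^-1 * \sum_(k < n) \1_(G k) x))%R.
  by rewrite RintegralZl// IG.
have isum : mu.-integrable setT
    (EFin \o (fun x => n%:R^-1 * \sum_(k < n) \1_(G k) x)%R).
  exact: (integrableZl measurableT n%:R^-1%R iG).
have sE x : (\sum_(k < n) \1_(G k) x =
    \sum_(k < n) (k%:R < n%:R * f x)%R%:R :> R)%R.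
  apply: eq_bigr => k _; rewrite indicE; congr (_%:R)%R; congr nat_of_bool.
  by apply/idP/idP => [/set_mem|] //; exact: mem_set.
have s01 x : (0 <= n%:R * f x <= n%:R)%R.
  by have /andP[? ?] := f01 x; rewrite mulr_ge0//= ler_piMr.
rewrite SE; apply/andP; split.
  apply: le_Rintegral => // x _; rewrite sE ler_pdivlMl//.
  have /andP[? ?] := s01 x.
  by case: (sum_indicator_lt (n%:R * f x) n) => _ + _; exact.
have -> : (n%:R^-1 * fine (mu setT) = \int[mu]_x n%:R^-1)%R by rewrite Rintegral_cst.
have ic := finite_measure_integrable_cst mu (n%:R^-1)%R measurableT.
rewrite -RintegralD//; apply: le_Rintegral => //.
  exact: (integrableD measurableT intf ic).
move=> x _; rewrite sE ler_pdivrMl// mulrDr divff ?gt_eqF//.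
have /andP[? ?] := s01 x.
by case: (sum_indicator_lt (n%:R * f x) n) => _ _; exact.
Qed.

(** * The Radon measure obtained from limits along a tight ultrafilter *)

Section limit_measure.
Context (R : realType) (T : ptopologicalType) (X : Type) (F : set_system X).
Context (P : X -> {finite_measure set (borel T) -> \bar R}%R).
Hypotheses (hT : tychonoff_space T) (FU : UltraFilter F) (b : R).
Hypothesis Pb : \forall x \near F, P x setT <= b%:E.
Hypothesis Ptight : forall e : R, (0 < e)%R -> exists2 C : set T,
  compact C & \forall x \near F, P x (~` C) <= e%:E.

Let FP : ProperFilter F. Proof. exact: ultra_proper. Qed.
Let q x (A : set (borel T)) : R := fine (P x A).
Implicit Types A B U V : set (borel T).

Let q_ge0 x A : (0 <= q x A)%R. Proof. exact: fine_ge0. Qed.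

Let qE x A : measurable A -> (q x A)%:E = P x A.
Proof. by move=> mA; rewrite fineK// fin_num_measure. Qed.

Let le_q x A B : measurable A -> measurable B -> A `<=` B -> (q x A <= q x B)%R.
Proof.
by move=> mA mB AB; rewrite -lee_fin !qE// le_measure//; exact: mem_set.
Qed.

Let q_leU x A B : measurable A -> measurable B ->
  (q x (A `|` B) <= q x A + q x B)%R.
Proof.
move=> mA mB; rewrite -lee_fin EFinD !qE//; last exact: measurableU.
exact: measureU2.
Qed.

Let qU x A B : measurable A -> measurable B -> A `&` B = set0 ->
  (q x (A `|` B) = q x A + q x B)%R.
Proof.
move=> mA mB AB; apply: EFin_inj; rewrite EFinD !qE//; last exact: measurableU.
by rewrite measureU.
Qed.

(** Measurability is placed under the existential so that choosing a limit defines a total function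
    [l]. *)
Let q_cvg A : exists l : R, measurable A -> q x A @[x --> F] --> l.
Proof.
have [mA|] := pselect (measurable A); last by exists 0%R.
suff [l ?] : exists l : R, q x A @[x --> F] --> l by exists l.
apply: (@ultra_cvg_bounded _ _ _ _ b) => //; apply: filterS Pb => x xb.
by rewrite ger0_norm// (le_trans (le_q x mA measurableT _))// -lee_fin qE.
Qed.

Let l A : R := sval (cid (q_cvg A)).

Let cvg_l A : measurable A -> q x A @[x --> F] --> l A.
Proof. exact: svalP (cid (q_cvg A)). Qed.

Let m (U : set T) : \bar R := (l U)%:E.

Let m0 : m set0 = 0.
Proof.
have := @cvg_l set0 measurable0.
have -> : (fun x => q x set0) = cst 0%R.
  by apply/funext => x; rewrite /q measure0.
by move=> /cvg_lim h; congr EFin; rewrite -h// lim_cst.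
Qed.

Let m_ge0 U : open U -> 0 <= m U.
Proof.
move=> oU; rewrite lee_fin; apply: (@ler_cvg _ _ _ (cst 0%R) _ _ _ FP).
- exact: cvg_cst.
- by apply: cvg_l; exact: open_borel.
- exact: nearW.
Qed.

Let m_le U V : open U -> open V -> U `<=` V -> m U <= m V.
Proof.
move=> /open_borel mU /open_borel mV UV; rewrite lee_fin.
apply: (ler_cvg FP (cvg_l mU) (cvg_l mV)); apply: nearW => x; exact: le_q.
Qed.

Let m_leU U V : open U -> open V -> m (U `|` V) <= m U + m V.
Proof.
move=> /open_borel mU /open_borel mV; rewrite -EFinD lee_fin.
apply: (ler_cvg FP (cvg_l (measurableU _ _ mU mV)) (cvgD (cvg_l mU) (cvg_l mV))).
by apply: nearW => x; exact: q_leU.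
Qed.

Let m_geU U V : open U -> open V -> U `&` V = set0 -> m U + m V <= m (U `|` V).
Proof.
move=> /open_borel mU /open_borel mV UV; rewrite -EFinD lee_fin.
apply: (ler_cvg FP (cvgD (cvg_l mU) (cvg_l mV)) (cvg_l (measurableU _ _ mU mV))).
by apply: nearW => x; rewrite /= qU.
Qed.

Let nu : radon_measure R T :=
  content_radon hT m0 m_ge0 (ltry _) m_le m_leU m_geU.

Let nu_ge0 : radon_ge0 nu. Proof. exact: content_radon_ge0. Qed.

Let nuT : nu setT = m setT.
Proof.
apply/eqP; rewrite eq_le content_radon_open_le/=; last exact: openT.
apply/lee_addgt0Pr => e e0; have [C cC PC] := Ptight e0.
have mC : measurable (C : set (borel T)).
  by apply: compact_borel cC; case: hT.
apply: (@le_trans _ _ (nu C + e%:E)); last first.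
  by apply: leeD2r; exact: le_radon.
rewrite -leeBlDr//; apply: content_radon_compact_ge => // U oU CU.
rewrite leeBlDr// -EFinD lee_fin.
have mU := open_borel oU.
apply: (ler_cvg FP (cvg_l measurableT) (cvgD (cvg_l mU) (cvg_cst e))).
apply: filterS PC => x; rewrite -qE; last exact: measurableC.
rewrite lee_fin => qC; apply: le_trans (lerD (lexx _) qC).
apply: le_trans (q_leU _ mU (measurableC mC)).
apply: le_q => //; first by apply: measurableU => //; exact: measurableC.
move=> y _; have [/CU|] := pselect (C y); first by left.
by right.
Qed.

Let I x (f : T -> R) : R := (\int[P x]_y f y)%R.
Let J (f : T -> R) : R := (\int[charge_pos nu]_y f y)%R.
Implicit Type f : T -> R.

Let qT : \forall x \near F, (q x setT <= b)%R.
Proof. by apply: filterS Pb => x; rewrite -lee_fin qE. Qed.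

Let I_cvg f : bounded_continuous f -> exists L : R, I x f @[x --> F] --> L.
Proof.
move=> bf; have [M M0 fM] := bounded_continuous_bound bf.
apply: (@ultra_cvg_bounded _ _ _ _ (M * b)) => //; apply: filterS qT => x xb.
apply: (@le_trans _ _ (M * q x setT)%R); last by rewrite ler_pM2l.
have intf := bounded_continuous_integrable (P x) bf.
apply: le_trans (le_normr_Rintegral measurableT intf) _.
rewrite -Rintegral_cst//; apply: le_Rintegral => //.
  exact: integrable_norm.
exact: finite_measure_integrable_cst.
Qed.

(** The layers of [f] are open, so [nu <= m] bounds the layer sum of [nu] by the limit of the layer
    sums of [P x]. These exceed [I x f] by at most [n^-1 * q x setT], which tends to
    [n^-1 * l setT]. *)
Let J_le01 f (L : R) : continuous f -> (forall y, 0 <= f y <= 1)%R ->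
  I x f @[x --> F] --> L -> (J f <= L)%R.
Proof.
move=> cf f01 fL; apply/ler_addgt0Pr => e e0.
have lT0 : (0 <= l setT)%R by rewrite -lee_fin; apply: m_ge0; exact: openT.
(* The archimedean bound makes the error [n^-1 * l setT] at most [e]; the successor ensures
   [n > 0]. *)
pose n := (Num.bound (l setT / e)).+1.
have n0 : (0 < n)%N by [].
have le_n : (n%:R^-1 * l setT <= e)%R.
  rewrite ler_pdivrMl ?ltr0n// -ler_pdivrMr//.
  have := archi_boundP (divr_ge0 lT0 (ltW e0)).
  by move=> /ltW h'; apply: (le_trans h'); rewrite ler_nat /n leqnSn.
pose G k : set T := [set y | k%:R < n%:R * f y]%R.
have oG k : open (G k) by exact: open_layer.
have /andP[h _] := Rintegral_layers (charge_pos nu) cf f01 n0.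
apply: (le_trans h).
have lG : (n%:R^-1 * \sum_(k < n) q x (G k))%R @[x --> F] -->
    (n%:R^-1 * \sum_(k < n) l (G k))%R.
  apply: cvgM; first exact: cvg_cst.
  apply: cvg_big => [|k _]; first exact: add_continuous.
  by apply: cvg_l; exact: open_borel.
apply: (@le_trans _ _ (n%:R^-1 * \sum_(k < n) l (G k))%R).
  rewrite ler_pM2l ?invr_gt0 ?ltr0n//; apply: ler_sum => k _.
  have mG := open_borel (oG k).
  rewrite -lee_fin fineK ?fin_num_measure// radon_posE//.
  by suff : nu (G k) <= m (G k) by []; exact: content_radon_open_le.
apply: (@le_trans _ _ (L + n%:R^-1 * l setT)%R); last by rewrite lerD2l.
have fL' : (I x f + n%:R^-1 * q x setT)%R @[x --> F] -->
    (L + n%:R^-1 * l setT)%R.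
  by apply: cvgD => //; apply: cvgM; [exact: cvg_cst|exact: cvg_l].
apply: (ler_cvg FP lG fL'); apply: nearW => x.
by have /andP[] := Rintegral_layers (P x) cf f01 n0.
Qed.

(** Apply the previous bound to [g = (f + M) / (2 * M)], with values in [0, 1]. The added constant
    contributes [M * nu setT] on one side and [M * l setT] on the other; they cancel by [nuT]. *)
Let J_le f (L : R) : bounded_continuous f ->
  I x f @[x --> F] --> L -> (J f <= L)%R.
Proof.
move=> bf fL; have [M M0 fM] := bounded_continuous_bound bf.
have M20 : (0 < 2 * M)%R by rewrite mulr_gt0.
pose g := (fun y => (2 * M)^-1 * (f y + M))%R.
have [cf _] := bf.
have gE (mu : {finite_measure set (borel T) -> \bar R}%R) :
    (\int[mu]_y g y = (2 * M)^-1 * (\int[mu]_y f y + M * fine (mu setT)))%R.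
  have intf := bounded_continuous_integrable mu bf.
  have intM := finite_measure_integrable_cst mu M measurableT.
  rewrite RintegralZl//; last exact: (integrableD measurableT intf intM).
  by rewrite RintegralD// Rintegral_cst.
have cg : continuous g.
  move=> y; apply: cvgM; first exact: cvg_cst.
  by apply: cvgD; [exact: cf|exact: cvg_cst].
have g01 y : (0 <= g y <= 1)%R.
  have := fM y; rewrite ler_norml /g => /andP[? ?].
  rewrite mulr_ge0 ?invr_ge0 ?(ltW M20)//=; last by lra.
  by rewrite ler_pdivrMl// mulr1; lra.
have gL : I x g @[x --> F] --> ((2 * M)^-1 * (L + M * l setT))%R.
  under eq_fun do rewrite /I gE.
  apply: cvgM; first exact: cvg_cst.
  by apply: cvgD => //; apply: cvgM; [exact: cvg_cst|exact: cvg_l].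
have := J_le01 cg g01 gL; rewrite /J gE ler_pM2l ?invr_gt0//.
by rewrite radon_posE// nuT lerD2r.
Qed.

Lemma tight_ultrafilter_cvg : exists nu : radon_measure R T, radon_ge0 nu /\
  forall f, bounded_continuous f ->
  (\int[P x]_y f y)%R @[x --> F] --> (\int[charge_pos nu]_y f y)%R.
Proof.
exists nu; split=> // f bf; have [L fL] := I_cvg bf.
suff LJ : L = J f by move: fL; rewrite LJ.
have bNf : bounded_continuous (fun y => - f y)%R.
  have [cf [M [Mr fM]]] := bf; split.
    by move=> y; apply: cvgN; exact: cf.
  by exists M; split=> // N MN y _; rewrite /= normrN; exact: fM.
have NE (mu : {finite_measure set (borel T) -> \bar R}%R) :
    (\int[mu]_y (- f y) = - \int[mu]_y f y)%R.
  have intf := bounded_continuous_integrable mu bf.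
  rewrite -mulN1r -RintegralZl//.
  by apply: eq_Rintegral => y _; rewrite mulN1r.
apply/eqP; rewrite eq_le J_le// andbT -lerN2.
have NL : I x (fun y => - f y)%R @[x --> F] --> (- L)%R.
  by under eq_fun do rewrite /I NE; exact: cvgN.
by have := J_le bNf NL; rewrite /J NE.
Qed.

End limit_measure.

(** The net is indexed by the members of [F] under reverse inclusion, with [mu A] chosen in [M] and
    in [A]. Tightness of a subnet passes to [F] because an ultrafilter contains each set or its
    complement. *)
Lemma ultrafilter_tight (R : realType) (T : ptopologicalType)
    (M : set (radon_measure R T)) (F : set_system (radon_measure R T)) (e : R) :
  eventually_tight_subnets M -> UltraFilter F -> F M -> (0 < e)%R ->
  exists2 C : set T, compact C &
    F [set mu : radon_measure R T | mu (~` C) < e%:E].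
Proof.
move=> alpha FU FM e0; have FP : ProperFilter F by exact: ultra_proper.
pose J := {A : set (radon_measure R T) | F A}.
pose leJ (A B : J) := sval B `<=` sval A.
have dJ : directed leJ.
  split=> [|A x //|A B D AB BD x Dx|[A FA] [B FB]].
  - by exists; exists setT; exact: filterT.
  - exact/AB/BD.
  - by exists (exist _ (A `&` B) (filterI FA FB)); split=> x [].
have /choice[mu muP] (A : J) : exists mu, M mu /\ sval A mu.
  by have [mu []] := filter_ex (filterI FM (svalP A)); exists mu.
have [I [leI [s [[_ _ _ dI] sub tight]]]] :=
  alpha J leJ dJ mu (fun A => (muP A).1).
have [C [i0 [[_ cC] hC]]] := tight e e0.
exists C; first by rewrite compact_cover.
have [//|FnC] :=
  in_ultra_setVsetC [set mu : radon_measure R T | mu (~` C) < e%:E] FU.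
have [i1 hi1] := sub (exist _ _ FnC).
have [i [/hC ltC /hi1 /(_ _ (muP (s i)).2)]] := dI i0 i1.
by [].
Qed.

Lemma cvg_weak (R : realType) (T : ptopologicalType)
    (F : set_system (radon_measure R T)) (nu : radon_measure R T) :
  Filter F ->
  (forall f : T -> R, bounded_continuous f ->
    (fun mu : radon_measure R T => charge_int mu f) @ F --> charge_int nu f) ->
  F --> nu.
Proof.
move=> FF Fnu U; rewrite nbhsE => - [V [oV Vnu] VU].
have {}oV : weak_open V := oV.
have [fs [e [e0 fsb feV]]] := oV nu Vnu.
apply: (@filterS _ F _ (weak_ball fs e nu)); first exact: subset_trans VU.
(* A weak ball involves finitely many functions, so it is a finite intersection of members of
   [F]. *)
elim: fs fsb {feV} => [_|f fs IH fsb]; first exact: filterS filterT.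
have bf : bounded_continuous f by apply: fsb; rewrite inE eqxx.
have /IH Ffs : {in fs, forall g, bounded_continuous g}.
  by move=> g gs; apply: fsb; rewrite inE gs orbT.
have /cvgrPdist_lt /(_ e e0) Ff := Fnu f bf.
apply: filterS2 Ff Ffs => mu fmu fsmu g; rewrite inE => /predU1P[->|/fsmu//].
by rewrite weak_distE// distrC.
Qed.

Theorem theorem5 (R : realType) (T : ptopologicalType)
  (hT : tychonoff_space T)
  (M : set (radon_measure R T))
  (M_neq0 : M !=set0)
  (M_ge0 : M `<=` @radon_ge0 R T)
  (M_closed : closed M)
  (alpha : eventually_tight_subnets M)
  (beta : ereal_sup [set mu [set: T] | mu in M] < +oo) :
  compact_hausdorff M.
Proof.
split; first exact: radon_ge0_hausdorff.
have [mu0 Mmu0] := M_neq0.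
(* An element of [M] supplies the base point of the pointed space in which compactness is tested by
   ultrafilters. *)
pose X : ptopologicalType :=
  HB.pack (radon_measure R T) (isPointed.Build (radon_measure R T) mu0).
suff cM : compact (M : set X) by rewrite compact_cover in cM.
rewrite compact_ultra => F FU FM; have FP : ProperFilter F by exact: ultra_proper.
have mass_le mu : M mu -> mu setT <= ereal_sup [set mu [set: T] | mu in M].
  by move=> Mmu; apply: ereal_sup_ubound; exists mu.
have mass_fin : ereal_sup [set mu [set: T] | mu in M] \is a fin_num.
  by rewrite ge0_fin_numE// (le_trans _ (mass_le _ Mmu0))//; exact: M_ge0.
have [||nu [nu0 Fnu]] := @tight_ultrafilter_cvg R T _ F
    (fun mu => charge_pos mu) hT FU
    (fine (ereal_sup [set mu [set: T] | mu in M])).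
- by apply: filterS FM => mu Mmu; rewrite radon_posE ?fineK ?mass_le//; exact: M_ge0.
- move=> e e0; have [C cC hC] := ultrafilter_tight alpha FU FM e0.
  exists C => //; apply: filterS2 FM hC => mu Mmu /ltW.
  rewrite radon_posE//; first exact: M_ge0.
  by apply: measurableC; apply: compact_borel cC; case: hT.
have {}Fnu : F --> (nu : X).
  apply: cvg_weak => f bf; rewrite (radon_ge0_charge_int _ nu0).
  (* [charge_int mu f] is known to be the integral against [charge_pos mu] for [mu] in [M], hence
     [F]-eventually. *)
  apply: cvg_trans (Fnu f bf); apply: near_eq_cvg.
  by apply: filterS FM => mu Mmu; rewrite radon_ge0_charge_int//; exact: M_ge0.
exists nu; split=> //; apply: M_closed => U nuU.
exact: filter_ex (filterI FM (Fnu _ nuU)).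
Qed.
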